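(* Let $v=6t$ where $t\ge 4$ and $t\ne 6$. Then there exists a $(v,3,2)$-BIBD $(X,\mathcal{A})$ that has a strong nesting $\phi:\mathcal{A}\to Y$, $X\subseteq Y$, with $|Y|=w=9t+2$.
   Context: A $(v,k,\lambda)$-BIBD is a pair $(X,\mathcal{A})$ where $X$ is a set of $v$ points and $\mathcal{A}$ is a multiset of $k$-subsets of $X$ (blocks) such that every pair of distinct points lies in exactly $\lambda$ blocks. Given a $(v,k,\lambda)$-BIBD $(X,\mathcal{A})$ and a set $Y\supseteq X$ with $|Y|=w$, a map $\phi:\mathcal{A}\to Y$ is a strong nesting if (1) $\phi(A)\notin A$ for every block $A\in\mathcal{A}$, and (2) the multiset of pairs $\{\{x,\phi(A)\}: A\in\mathcal{A},\ x\in A\}$ (one pair for each block $A$, counted with multiplicity in $\mathcal{A}$, and each $x\in A$) consists of distinct pairs. *)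

(* Defs.v *)
From mathcomp Require Import all_boot.
Set Implicit Arguments. Unset Strict Implicit. Unset Printing Implicit Defensive.

(* A design on point set X (a subset of the ambient finite type T), with
   b blocks indexed by 'I_b (so repeated blocks are allowed: a multiset). *)
Definition is_BIBD (T : finType) (X : {set T}) (v k lam b : nat)
    (B : 'I_b -> {set T}) : Prop :=
  #|X| = v /\
  (forall i, B i \subset X) /\
  (forall i, #|B i| = k) /\
  (forall x y, x \in X -> y \in X -> x != y ->
     #|[set i | (x \in B i) && (y \in B i)]| = lam).

(* Strong nesting phi : blocks -> Y (here Y = the ambient type T):
   (1) phi(A) not in A; (2) the pairs {x, phi(A)} (A a block, counted with
   multiplicity, x in A) are pairwise distinct. *)
Definition strong_nesting (T : finType) (b : nat) (B : 'I_b -> {set T})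
    (phi : 'I_b -> T) : Prop :=
  (forall i, phi i \notin B i) /\
  (forall i j x y, x \in B i -> y \in B j ->
     [set x; phi i] = [set y; phi j] -> i = j /\ x = y).

(* Main.v *)
Require Import Defs.
From mathcomp Require Import all_boot all_algebra zify.
Set Implicit Arguments. Unset Strict Implicit. Unset Printing Implicit Defensive.
Import GRing.Theory.

(* A frame on [t] groups has 6 points and 3 infinite points per group. Its blocks are
   triples of points from distinct groups, every pair of points from distinct groups
   lies in two blocks, and each block is nested at a point or infinite point of a group
   that it misses, all the resulting pairs being distinct. Adding two more infinite
   points and filling each group by a (6,3,2)-BIBD strongly nested into 6 + 3 + 2 points
   gives the theorem.

   Placing frames on the lines of a linear space (a pairwise balanced design) gives a
   frame on its points. The lines [y = m x + b] over Z_q, with [q] prime to 6, form a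
   transversal design with six groups of size [q]; truncating two groups to sizes [r] and
   [s] gives linear spaces on [4q + r + s] points with lines of size 4, 5, 6, [q], [r]
   and [s]. This reduces all [t >= 4] to twenty-one values, for which a frame is developed
   cyclically over Z_6t from base blocks found by computer search. *)

(** * Weighted systems of nested triples: unions, relabelling and the passage to BIBDs *)

Section NestedDesign.
Variable T : eqType.
Implicit Types (s : seq (seq T * T)) (E N : T -> T -> nat).

Definition covers s x y := count (fun p => (x \in p.1) && (y \in p.1)) s.

Definition spokes s x y := count (fun p => (x \in p.1) && (y == p.2)) s.

Definition triples_in s := all (fun p => uniq p.1 && (size p.1 == 3)) s.

(* A system of triples, each paired with the point it is nested at: [x] and [y] lie
   together in [2 * E x y] triples, and [{x, y}] arises at most [N x y] times from the
   nesting. Numerical weights make disjoint unions additive. *)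
Definition nested_design E N := exists s,
  [/\ triples_in s, forall x y, x != y -> covers s x y = 2 * E x y
    & forall x y, spokes s x y + spokes s y x <= N x y].

Lemma nested_design0 : nested_design (fun _ _ => 0) (fun _ _ => 0).
Proof. by exists [::]. Qed.

Lemma nested_design_le E N E' N' :
    (forall x y, x != y -> E' x y = E x y) -> (forall x y, N x y <= N' x y) ->
  nested_design E N -> nested_design E' N'.
Proof.
move=> eE leN [s [s3 sE sN]]; exists s; split=> // x y; first by move=> /[dup]/sE-> /eE->.
exact: leq_trans (sN x y) (leN x y).
Qed.

Lemma nested_designD E1 N1 E2 N2 : nested_design E1 N1 -> nested_design E2 N2 ->
  nested_design (fun x y => E1 x y + E2 x y) (fun x y => N1 x y + N2 x y).
Proof.
move=> [s1 [s13 s1E s1N]] [s2 [s23 s2E s2N]]; exists (s1 ++ s2); split.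
- by rewrite /triples_in all_cat; apply/andP.
- by move=> x y xy; rewrite /covers count_cat mulnDr -s1E // -s2E.
by move=> x y; rewrite /spokes !count_cat addnACA leq_add ?s1N ?s2N.
Qed.

Lemma nested_design_sum (K : eqType) (ks : seq K) (E N : K -> T -> T -> nat) :
    {in ks, forall k, nested_design (E k) (N k)} ->
  nested_design (fun x y => \sum_(k <- ks) E k x y) (fun x y => \sum_(k <- ks) N k x y).
Proof.
elim: ks => [|k ks IH] H.
  by refine (nested_design_le _ _ nested_design0) => x y; rewrite big_nil.
have Hks : {in ks, forall k', nested_design (E k') (N k')}.
  by move=> k' k'ks; apply: H; rewrite inE k'ks orbT.
by refine (nested_design_le _ _ (nested_designD (H k (mem_head _ _)) (IH Hks))) => x y;
  rewrite big_cons.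
Qed.

End NestedDesign.

(** The image system has no triple and no spoke on a pair outside the image of [f]; the last
    hypothesis makes [E'] vanish there as well, so the counts agree everywhere. *)
Lemma nested_design_inj (T T' : eqType) (f : T -> T') (E N : T -> T -> nat)
    (E' N' : T' -> T' -> nat) :
    injective f ->
    (forall x y, x != y -> E' (f x) (f y) = E x y) ->
    (forall x y, N x y <= N' (f x) (f y)) ->
    (forall x y, x != y -> 0 < E' x y -> exists x0 y0, x = f x0 /\ y = f y0) ->
  nested_design E N -> nested_design E' N'.
Proof.
move=> finj eE leN imE [s [s3 sE sN]].
exists [seq (map f p.1, f p.2) | p <- s].
have cov x y : covers [seq (map f p.1, f p.2) | p <- s] (f x) (f y) = covers s x y.
  by rewrite /covers count_map; apply: eq_count => p /=; rewrite !mem_map.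
have spk x y : spokes [seq (map f p.1, f p.2) | p <- s] (f x) (f y) = spokes s x y.
  by rewrite /spokes count_map; apply: eq_count => p /=; rewrite mem_map // inj_eq.
have spk0 x y : 0 < spokes [seq (map f p.1, f p.2) | p <- s] x y ->
    exists x0 y0, x = f x0 /\ y = f y0.
  rewrite -has_count => /hasP[_ /mapP[p _ ->]] /= /andP[/mapP[x0 _ ->] /eqP->].
  by exists x0, p.2.
split.
- by rewrite /triples_in all_map; apply: sub_all s3 => p /=; rewrite map_inj_uniq // size_map.
- move=> x y xy.
  have main : (exists x0 y0, x = f x0 /\ y = f y0) ->
      covers [seq (map f p.1, f p.2) | p <- s] x y = 2 * E' x y.
    move=> [x0 [y0 [def_x def_y]]]; move: xy.
    by rewrite def_x def_y cov (inj_eq finj) => xy; rewrite eE // sE.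
  have [E0|/(imE _ _ xy)//] := posnP (E' x y).
  have [->|] := posnP (covers [seq (map f p.1, f p.2) | p <- s] x y); first by rewrite E0.
  rewrite -has_count => /hasP[_ /mapP[p _ ->]] /= /andP[/mapP[x0 _ ?] /mapP[y0 _ ?]].
  by apply: main; exists x0, y0.
move=> x y; have [S0|] := posnP (spokes [seq (map f p.1, f p.2) | p <- s] x y).
  have [S1|] := posnP (spokes [seq (map f p.1, f p.2) | p <- s] y x).
    by rewrite S0 S1.
  by move=> /spk0[y0 [x0 [-> ->]]]; rewrite !spk; apply: leq_trans (sN _ _) (leN _ _).
by move=> /spk0[x0 [y0 [-> ->]]]; rewrite !spk; apply: leq_trans (sN _ _) (leN _ _).
Qed.

(** Indexing the blocks by positions in [s] keeps repeated triples. The bound on [N] gives both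
    nesting conditions: at [x = y] no triple contains its own nesting point, and off the diagonal no
    pair arises twice. *)
Lemma nested_design_BIBD (T : finType) (X : {set T}) (E N : T -> T -> nat) :
    (forall x y, x != y -> E x y = (x \in X) && (y \in X)) ->
    (forall x y, N x y <= (x != y)) ->
    nested_design E N ->
  exists (b : nat) (B : 'I_b -> {set T}) (phi : 'I_b -> T),
    is_BIBD X #|X| 3 2 B /\ strong_nesting B phi.
Proof.
move=> eE leN [s [s3 sE sN]].
have sN1 x y : spokes s x y + spokes s y x <= (x != y).
  exact: leq_trans (sN x y) (leN x y).
pose p (i : 'I_(size s)) := tnth (in_tuple s) i.
have p3 i : uniq (p i).1 /\ size (p i).1 = 3.
  have /(allP s3)/andP[? /eqP?] : p i \in s by apply: mem_tnth.
  by [].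
have countE (a : pred (seq T * T)) : count a s = #|[set i | a (p i)]|.
  rewrite cardsE -sum1_card -sum1_count -[in LHS](in_tupleE s) big_tuple.
  by [].
exists (size s), (fun i => [set x in (p i).1]), (fun i => (p i).2).
have phiN i : (p i).2 \notin (p i).1.
  apply/negP => phi_in; have := sN1 (p i).2 (p i).2; rewrite eqxx leqn0 addn_eq0 andbb.
  rewrite /spokes countE cards_eq0 => /eqP/setP/(_ i).
  by rewrite !inE phi_in eqxx.
split; split.
- by [].
- split=> [i|].
    apply/subsetP => x; rewrite inE => xi.
    (* The block covers [x] together with some second point [y]; then [E x y] is positive, which
       forces [x] into [X]. *)
    have [y yi xy] : exists2 y, y \in (p i).1 & x != y.
      have [+ +] := p3 i; case: (p i).1 xi => [|a [|b [|c [|? ?]]]] //= _.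
      rewrite !inE negb_or -andbA => /and4P[ab _ _ _] _.
      have [xa|xa] := eqVneq x a; first by exists b; rewrite ?xa // !inE eqxx orbT.
      by exists a; rewrite ?mem_head.
    have := sE x y xy; rewrite eE // /covers countE.
    case: (x \in X) => //= /eqP; rewrite cards_eq0 => /eqP/setP/(_ i).
    by rewrite !inE xi yi.
  split=> [i|x y xX yX xy]; first by have [/card_uniqP U <-] := p3 i; rewrite cardsE.
  have := sE x y xy; rewrite eE // xX yX /covers countE muln1 => <-.
  by apply: eq_card => i; rewrite !inE.
- by move=> i; rewrite inE.
move=> i j x y; rewrite !inE => xi yj eqxy.
have twice a b i1 i2 : a \in (p i1).1 -> b = (p i1).2 -> a \in (p i2).1 -> b = (p i2).2 -> i1 = i2.
  move=> ai1 bi1 ai2 bi2; apply/eqP; apply: contraT => i12.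
  have : 1 < spokes s a b.
    rewrite /spokes countE; have <- : #|[set i1; i2]| = 2 by rewrite cards2 i12.
    apply/subset_leq_card/subsetP => k; rewrite !inE => /orP[] /eqP->.
      by rewrite ai1 bi1 eqxx.
    by rewrite ai2 bi2 eqxx.
  have := leq_trans (sN1 a b) (leq_b1 _); lia.
have : x \in [set y; (p j).2] by rewrite -eqxy !inE eqxx.
have : (p i).2 \in [set y; (p j).2] by rewrite -eqxy !inE eqxx orbT.
(* Of the four ways to match the two pairs, two put a nesting point into its own block, the crossed
   one counts the pair in both directions, and the remaining one is settled by [twice]. *)
rewrite !inE => /orP[] /eqP ei /orP[] /eqP xe.
- by move: (phiN i); rewrite ei -xe xi.
- have : 0 < spokes s x (p i).2.
    by rewrite -has_count; apply/hasP; exists (p i); rewrite ?mem_tnth // xi eqxx.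
  have : 0 < spokes s (p i).2 x.
    rewrite -has_count; apply/hasP; exists (p j); rewrite ?mem_tnth //.
    by rewrite ei yj xe eqxx.
  have := leq_trans (sN1 x (p i).2) (leq_b1 _); lia.
- split=> //; apply: (twice x (p i).2) => //; by rewrite ?xe.
- by move: (phiN i); rewrite ei -xe xi.
Qed.

(** * Development of base blocks over a finite abelian group *)

Section Develop.
Variables (V : finZmodType) (W : zmodType) (pi : V -> W).
Hypothesis piB : {morph pi : x y / (x - y)%R}.
Implicit Types (p : seq V) (x y g : V).

Definition develop (phi : V -> V + W) (ps : seq (seq V)) : seq (seq (V + W) * (V + W)) :=
  flatten [seq [seq ([seq inl (a + g)%R | a <- p], phi g) | g <- enum V] | p <- ps].

Definition differences p := [seq (a - b)%R | a <- p, b <- p].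

Lemma count_develop P phi ps :
  count P (develop phi ps) =
  \sum_(p <- ps) count (fun g => P ([seq inl (a + g)%R | a <- p], phi g)) (enum V).
Proof.
rewrite /develop count_flatten -map_comp sumnE big_map.
by apply: eq_bigr => p _; rewrite /= count_map.
Qed.

Lemma mem_translate p x g :
  (inl x \in [seq inl (a + g)%R : V + W | a <- p]) = ((x - g)%R \in p).
Proof.
apply/mapP/idP => [[a ap [->]]|xgp]; first by rewrite addrK.
by exists (x - g)%R; rewrite ?subrK.
Qed.

Lemma inr_translate p g (w : W) : (inr w \in [seq inl (a + g)%R : V + W | a <- p]) = false.
Proof. by apply/negP => /mapP[]. Qed.

(** The substitution [g = x - a] turns a count over translations into a count over one base
    block. *)
Lemma count_enum_sub x p (P : pred V) : uniq p ->
  count (fun g => ((x - g)%R \in p) && P g) (enum V) = count (fun a => P (x - a)%R) p.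
Proof.
move=> p_uniq; rewrite -!size_filter.
have U1 : uniq [seq g <- enum V | ((x - g)%R \in p) && P g] by rewrite filter_uniq ?enum_uniq.
have U2 : uniq [seq (x - a)%R | a <- [seq a <- p | P (x - a)%R]].
  by rewrite map_inj_uniq ?filter_uniq //; apply: inj_comp (addrI _) oppr_inj.
rewrite -[RHS](size_map (fun a => x - a)%R); apply/perm_size/uniq_perm => // g.
rewrite mem_filter mem_enum andbT; apply/andP/mapP => [[gp Pg]|[a]].
  by exists (x - g)%R; rewrite ?mem_filter opprB addrC subrK ?Pg.
by rewrite mem_filter => /andP[Pa ap] ->; rewrite opprB addrC subrK.
Qed.

Lemma count_develop0 P phi ps :
  (forall p g, P ([seq inl (a + g)%R | a <- p], phi g) = false) -> count P (develop phi ps) = 0.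
Proof.
move=> P0; apply/eqP; rewrite count_develop big1 // => p _.
by rewrite (eq_count (a2 := pred0)) ?count_pred0 // => g; apply: P0.
Qed.

(** The translate by [g] contains [x] and [y] exactly when [x - g = a] and [y - g = b] for some [a],
    [b] in the block; then [a - b = x - y], and each such pair determines [g = x - a]. *)
Lemma covers_develop phi ps x y : all uniq ps ->
  covers (develop phi ps) (inl x) (inl y) =
  count_mem (x - y)%R (flatten (map differences ps)).
Proof.
move=> /allP ps_uniq; rewrite /covers count_develop count_flatten -map_comp sumnE big_map.
apply: eq_big_seq => p /ps_uniq p_uniq /=.
under eq_count do rewrite !mem_translate.
rewrite count_enum_sub // /differences count_flatten -map_comp sumnE big_map.
rewrite -sum1_count big_mkcond /=; apply: eq_bigr => a _.
rewrite count_map /= (eq_count (a2 := pred1 (y - (x - a))%R)) => [|b /=].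
  by rewrite count_uniq_mem //; case: (_ \in p).
by rewrite (can2_eq (subKr a) (subKr a)) !opprB addrCA.
Qed.

(** The translates of [p] through [x] are those by [x - a] with [a] in [p], and [pi (x - a) = w]
    amounts to [pi a = pi x - w]. *)
Lemma spokes_develop_inr ps x (w : W) : all uniq ps ->
  spokes (develop (fun g => inr (pi g)) ps) (inl x) (inr w) =
  count_mem (pi x - w)%R (map pi (flatten ps)).
Proof.
move=> /allP ps_uniq; rewrite /spokes count_develop count_map count_flatten sumnE big_map.
apply: eq_big_seq => p /ps_uniq p_uniq /=.
under eq_count do rewrite mem_translate.
rewrite (count_enum_sub x (fun g => inr w == inr (pi g) :> V + W)) //.
apply: eq_count => a /=; rewrite piB.
rewrite -[RHS](inj_eq (subrI (pi x))) subKr eq_sym //.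
Qed.

Lemma spokes_develop_inl ps x y : all uniq ps ->
  spokes (develop inl ps) (inl x) (inl y) = count_mem (x - y)%R (flatten ps).
Proof.
move=> /allP ps_uniq; rewrite /spokes count_develop count_flatten sumnE big_map.
apply: eq_big_seq => p /ps_uniq p_uniq /=.
under eq_count do rewrite mem_translate.
rewrite (count_enum_sub x (fun g => inl y == inl g :> V + W)) //.
apply: eq_count => a /=.
rewrite -[RHS](inj_eq (subrI x)) subKr eq_sym //.
Qed.

(* Nesting the translate [A + g] of a block at the infinite point [pi g] and the
   translate [B + g] at [g] itself turns all conditions on the design into
   conditions on the differences of the base blocks. *)
Lemma develop_nested_design (HV : pred V) (HW : pred W) (As Bs : seq (seq V)) :
    (forall x, HW (pi x) = HV x) -> (forall x, HV (- x)%R = HV x) ->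
    all (fun p => uniq p && (size p == 3)) (As ++ Bs) ->
    (forall d, d != 0%R ->
      count_mem d (flatten (map differences (As ++ Bs))) = 2 * HV d) ->
    uniq (map pi (flatten As)) -> all HV (flatten As) ->
    uniq (flatten Bs ++ map (@GRing.opp V) (flatten Bs)) -> all HV (flatten Bs) ->
  nested_design (T := (V + W)%type)
    (fun u v => if (u, v) is (inl x, inl y) then HV (x - y)%R else 0)
    (fun u v => match u, v with
                | inl x, inl y => HV (x - y)%R
                | inl x, inr w | inr w, inl x => HW (pi x - w)%R
                | inr _, inr _ => 0 end).
Proof.
move=> HWpi HVN tri diff uA hA uB hB.
have triP (phi : V -> (V + W)%type) ps :
    all (fun p => uniq p && (size p == 3)) ps -> triples_in (develop phi ps).
  move=> /allP ps3; apply/allP => q /flatten_mapP[p /ps3/andP[pu p3] /mapP[g _ ->]] /=.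
  rewrite map_inj_uniq ?size_map ?pu ?p3 // => a b [] /addIr; exact.
move: (tri); rewrite all_cat => /andP[tA tB].
have uAs : all uniq As by apply: sub_all tA => p /andP[].
have uBs : all uniq Bs by apply: sub_all tB => p /andP[].
exists (develop (fun g => inr (pi g)) As ++ develop inl Bs); split.
- by rewrite /triples_in all_cat; apply/andP; split; apply: triP.
- have cov0 phi ps (u : (V + W)%type) w : covers (develop phi ps) u (inr w) = 0.
    by apply: count_develop0 => p g; rewrite inr_translate andbF.
  have cov0' phi ps (u : (V + W)%type) w : covers (develop phi ps) (inr w) u = 0.
    by apply: count_develop0 => p g; rewrite inr_translate.
  have coverD u v : covers (develop (fun g => inr (pi g)) As ++ develop inl Bs) u v =
    covers (develop (fun g => inr (pi g)) As) u v + covers (develop inl Bs) u v by exact: count_cat.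
  move=> [x|w] [y|w'] xy; rewrite coverD ?cov0 ?cov0' //.
  rewrite !covers_develop // -count_cat -flatten_cat -map_cat diff // subr_eq0.
  by apply: contraNneq xy => ->.
have spokeD u v : spokes (develop (fun g => inr (pi g)) As ++ develop inl Bs) u v =
  spokes (develop (fun g => inr (pi g)) As) u v + spokes (develop inl Bs) u v by exact: count_cat.
have spoke0 phi ps (u : (V + W)%type) w : spokes (develop phi ps) (inr w) u = 0.
  by apply: count_develop0 => p g; rewrite inr_translate.
have spokeA x y : spokes (develop (fun g => inr (pi g)) As) (inl x) (inl y) = 0.
  by apply: count_develop0 => p g; rewrite andbF.
have spokeB x w : spokes (develop inl Bs) (inl x) (inr w) = 0.
  by apply: count_develop0 => p g; rewrite andbF.
have inA x w : spokes (develop (fun g => inr (pi g)) As) (inl x) (inr w) <= HW (pi x - w)%R.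
  rewrite spokes_develop_inr // count_uniq_mem //.
  by case: (boolP (_ \in _)) => // /mapP[a aA ->]; rewrite HWpi (allP hA).
move=> [x|w] [y|w']; rewrite !spokeD ?spoke0 ?spokeA ?spokeB ?addn0 ?add0n //.
rewrite !spokes_develop_inl //.
(* A pair nested at [x] instead of [y] has the opposite difference, so uniqueness of [flatten Bs]
   together with its negatives bounds both directions at once. *)
have -> : count_mem (y - x)%R (flatten Bs) = count_mem (x - y)%R (map (@GRing.opp V) (flatten Bs)).
  by rewrite count_map; apply: eq_count => b /=; rewrite eqr_oppLR opprB.
rewrite -count_cat count_uniq_mem // mem_cat.
case: (boolP (_ || _)) => // /orP[xyB|/mapP[b bB ->]]; first by rewrite (allP hB).
by rewrite HVN (allP hB).
Qed.

End Develop.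

(** * Frames from starters over the integers mod [6t] *)

Lemma val_ZpD n (x y : 'Z_n) : 1 < n -> (x + y)%R = (x + y) %% n :> nat.
Proof. by move=> n_gt1; congr (_ %% _); apply: Zp_cast. Qed.

Lemma val_ZpN n (x : 'Z_n) : 1 < n -> (- x)%R = (n - x) %% n :> nat.
Proof. by move=> n_gt1; congr ((_ - _) %% _); apply: Zp_cast. Qed.

Lemma ltn_Zp n (x : 'Z_n) : 1 < n -> x < n.
Proof. by move=> n_gt1; apply: leq_trans (ltn_ord x) _; rewrite Zp_cast. Qed.

Lemma natr_Zp_eqmod n m (x : 'Z_n) : 1 < n -> m = x %[mod n] -> m%:R%R = x.
Proof.
by move=> n_gt1 mx; apply: ord_inj; rewrite val_Zp_nat // mx modn_small ?ltn_Zp.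
Qed.

Lemma dvdn_modl d n m : d %| n -> (d %| m %% n) = (d %| m).
Proof. by move=> dn; rewrite /dvdn modn_dvdm. Qed.

Lemma dvdn_ZpB d n (x y : 'Z_n) : 1 < n -> d %| n ->
  (d %| (x - y)%R) = (x == y %[mod d]).
Proof.
move=> n_gt1 dn; rewrite -[in RHS](subrK y x); move: (x - y)%R => z.
by rewrite val_ZpD // modn_dvdm // -[X in _ == X %[mod _]]add0n eqn_modDr mod0n.
Qed.

Lemma dvdn_ZpN d n (x : 'Z_n) : 1 < n -> d %| n -> (d %| (- x)%R) = (d %| x).
Proof.
by move=> n_gt1 dn; rewrite val_ZpN // dvdn_modl // dvdn_subr // ltnW // ltn_Zp.
Qed.

Lemma val_differences n p : 1 < n -> all (fun a => a < n) p ->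
  [seq nat_of_ord d | d <- differences [seq (a%:R)%R : 'Z_n | a <- p]] =
  [seq (a + (n - b)) %% n | a <- p, b <- p].
Proof.
move=> n_gt1 /allP p_lt; rewrite /differences map_flatten -!map_comp; congr flatten.
apply/eq_in_map => a ap /=; rewrite -!map_comp; apply/eq_in_map => b bp.
transitivity (nat_of_ord (a%:R - b%:R : 'Z_n)%R) => //.
by rewrite val_ZpD // val_ZpN // !val_Zp_nat // modnDm (modn_small (p_lt b bp)).
Qed.

(* In group [g], the points are [(g, 0), ..., (g, 5)] and the infinite points are
   [(g, 6), (g, 7), (g, 8)]. *)
Definition nested_frame (G : finType) := nested_design (T := (G * 'I_9)%type)
  (fun u v => [&& u.1 != v.1, u.2 < 6 & v.2 < 6] : nat)
  (fun u v => u.1 != v.1 : nat).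

(* Over Z_6t, with the residue mod [t] as group, the translate [A + g] is nested at the
   infinite point [g mod 3t] and the translate [B + g] at the point [g]. *)
Definition frame_starter t (As Bs : seq (seq nat)) :=
  let n := 6 * t in
  let diffs := flatten [seq [seq (a + (n - b)) %% n | a <- p, b <- p] | p <- As ++ Bs] in
  let units := [seq d <- iota 0 n | ~~ (t %| d)] in
  [&& all (fun p => uniq p && (size p == 3)) (As ++ Bs),
      all (fun a => (a < n) && ~~ (t %| a)) (flatten (As ++ Bs)),
      sort leq [seq d <- diffs | d != 0] == sort leq (units ++ units),
      uniq [seq a %% (3 * t) | a <- flatten As]
    & uniq (flatten Bs ++ [seq n - b | b <- flatten Bs])].

(** This is [develop_nested_design] with [V = Z_6t], [W = Z_3t] and [pi] the reduction mod [3t];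
    distinct groups mean a difference not divisible by [t]. *)
Lemma starter_frame t As Bs : frame_starter t As Bs -> nested_frame 'I_t.
Proof.
case: t => [|t'].
  by move=> _; refine (nested_design_le _ _ (nested_design0 _)) => // [[[]]].
set t := t'.+1; move=> /and5P[tri rng /eqP/(perm_sortP leq_total leq_trans anti_leq) dif uA uB].
pose n := 6 * t; have n_gt1 : 1 < n by lia.
have n3_gt1 : 1 < 3 * t by lia.
have tn : t %| n by rewrite dvdn_mull.
have tn3 : t %| 3 * t by rewrite dvdn_mull.
have n3n : 3 * t %| n by rewrite /n -[6]/(2 * 3) -mulnA dvdn_mull.
pose V : finZmodType := 'Z_n; pose W : zmodType := 'Z_(3 * t).
pose pi (x : 'Z_n) : 'Z_(3 * t) := ((x : nat)%:R)%R.
have val_pi x : pi x = x %% (3 * t) :> nat by rewrite val_Zp_nat.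
have piD x y : pi (x + y)%R = (pi x + pi y)%R.
  apply: natr_Zp_eqmod => //; rewrite !val_ZpD // !val_pi !modn_mod modn_dvdm //.
  by rewrite modnDm.
have piB : {morph pi : x y / (x - y)%R}.
  by move=> x y; apply/eqP; rewrite eq_sym subr_eq -piD subrK.
pose HV (x : V) := ~~ (t %| (x : 'Z_n)); pose HW (w : W) := ~~ (t %| (w : 'Z_(3 * t))).
pose toV (ps : seq (seq nat)) : seq (seq 'Z_n) := [seq [seq a%:R%R | a <- p] | p <- ps].
have ltn_blk p a : p \in As ++ Bs -> a \in p -> a < n.
  move=> p_in ap; have /(allP rng)/andP[]// : a \in flatten (As ++ Bs).
  by apply/flattenP; exists p.
have rngA : {in flatten As, forall a, (a < n) && ~~ (t %| a)}.
  by move=> a aA; apply: (allP rng); rewrite flatten_cat mem_cat aA.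
have rngB : {in flatten Bs, forall a, (a < n) && ~~ (t %| a)}.
  by move=> a aB; apply: (allP rng); rewrite flatten_cat mem_cat aB orbT.
have valK a : a < n -> ((a%:R)%R : 'Z_n) = a :> nat.
  by move=> an; rewrite val_Zp_nat // modn_small.
have HVK a : a < n -> HV (a%:R)%R = ~~ (t %| a) by move=> an; rewrite /HV valK.
have base : nested_design (T := (V + W)%type)
    (fun u v => if (u, v) is (inl x, inl y) then HV (x - y)%R else 0)
    (fun u v => match u, v with
                | inl x, inl y => HV (x - y)%R
                | inl x, inr w | inr w, inl x => HW (pi x - w)%R
                | inr _, inr _ => 0 end).
  apply: (develop_nested_design piB (As := toV As) (Bs := toV Bs)).
  - by move=> x; rewrite /HW val_pi dvdn_modl.
  - by move=> x; rewrite /HV dvdn_ZpN.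
  - rewrite -map_cat all_map; apply/allP => p p_in /=; have /andP[pu p3] := allP tri p p_in.
    rewrite size_map p3 map_inj_in_uniq ?pu // => a b ap bp /(congr1 val) /=.
    by rewrite !valK ?(ltn_blk p).
  - move=> d d0; rewrite -map_cat.
    have -> : count_mem d (flatten (map (differences (V := V)) (toV (As ++ Bs)))) =
        count_mem (d : nat)
          (flatten [seq [seq (a + (n - b)) %% n | a <- p, b <- p] | p <- As ++ Bs]).
      have -> : [seq [seq (a + (n - b)) %% n | a <- p, b <- p] | p <- As ++ Bs] =
          map (map (fun d : 'Z_n => d : nat)) (map (differences (V := V)) (toV (As ++ Bs))).
        rewrite /toV -!map_comp; apply/eq_in_map => p p_in /=; rewrite val_differences //.
        by apply/allP => a; apply: ltn_blk.
      by rewrite -map_flatten count_map; apply: eq_count => x.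
    (* Equality after sorting makes the nonzero differences a permutation of [units ++ units], so
       each nonzero [d] occurs twice if [t] does not divide it and never otherwise. *)
    move/permP: dif => /(_ (pred1 (d : nat))).
    rewrite count_filter count_cat addnn -mul2n.
    rewrite (eq_count (a2 := pred1 (d : nat))); last first.
      by move=> k /=; case: eqP => // ->.
    move=> ->; congr (2 * _); rewrite count_uniq_mem ?filter_uniq ?iota_uniq //.
    by rewrite mem_filter mem_iota /= ltn_Zp // andbT.
  - rewrite /toV -map_flatten -map_comp -(map_inj_uniq (@ord_inj _)) -map_comp.
    rewrite (eq_map (g := fun a => a %% (3 * t))) // => a /=.
    by rewrite val_pi val_Zp_nat // modn_dvdm.
  - rewrite /toV -map_flatten all_map; apply/allP => a /rngA/andP[an ta] /=.
    by rewrite HVK.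
  - rewrite /toV -map_flatten -(map_inj_uniq (@ord_inj _)) map_cat -!map_comp.
    rewrite -[X in uniq (X ++ _)]map_id in uB; apply: etrans uB.
    congr (uniq (_ ++ _)); apply/eq_in_map => b /rngB/andP[bn tb].
      by rewrite /= valK.
    (* The number [n - b] is already reduced: [b] is nonzero, since [t] does not divide it. *)
    transitivity (nat_of_ord (- b%:R : 'Z_n)%R) => //.
    rewrite val_ZpN // valK // modn_small // ltn_subrL; apply/andP; split; last by lia.
    by case: b tb {bn}.
  - rewrite /toV -map_flatten all_map; apply/allP => a /rngB/andP[an ta] /=.
    by rewrite HVK.
(* The residue mod [t] is the group; the quotient by [t] runs from 0 to 5 for points and, shifted by
   6, from 6 to 8 for infinite points. *)
pose f (u : (V + W)%type) : 'I_t * 'I_9 :=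
  match u with
  | inl x => (inord ((x : 'Z_n) %% t), inord ((x : 'Z_n) %/ t))
  | inr w => (inord ((w : 'Z_(3 * t)) %% t), inord (6 + (w : 'Z_(3 * t)) %/ t))
  end.
have t_gt0 : 0 < t by [].
have div6 (x : 'Z_n) : x %/ t < 6 by rewrite ltn_divLR // ltn_Zp.
have div3 (w : 'Z_(3 * t)) : w %/ t < 3 by rewrite ltn_divLR // ltn_Zp.
have f1l x : (f (inl x)).1 = x %% t :> nat by rewrite /= inordK // ltn_pmod.
have f1r w : (f (inr w)).1 = w %% t :> nat by rewrite /= inordK // ltn_pmod.
have f2l x : (f (inl x)).2 = x %/ t :> nat by rewrite /= inordK // (leq_trans (div6 x)).
have f2r w : (f (inr w)).2 = 6 + w %/ t :> nat by rewrite /= inordK //; have := div3 w; lia.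
have f2N w : ((f (inr w)).2 < 6) = false by rewrite f2r ltnNge leq_addr.
apply: (nested_design_inj (f := f)) base.
- move=> [x|w] [y|w'] fuv; have f1 := congr1 (fun z => nat_of_ord z.1) fuv;
    have f2 := congr1 (fun z => nat_of_ord z.2) fuv;
    rewrite ?f1l ?f1r ?f2l ?f2r in f1 f2.
  + by congr inl; apply: ord_inj; rewrite (divn_eq x t) (divn_eq y t) f1 f2.
  + by move: (div6 x); rewrite f2 ltnNge leq_addr.
  + by move: (div6 y); rewrite -f2 ltnNge leq_addr.
  + by congr inr; apply: ord_inj; rewrite (divn_eq w t) (divn_eq w' t) f1 (addnI f2).
- move=> [x|w] [y|w'] xy.
  + by rewrite !f2l !div6 !andbT -val_eqE [val _]f1l [X in _ != X]f1l /HV dvdn_ZpB.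
  + by rewrite f2N ?andbF.
  + by rewrite f2N ?andbF.
  + by rewrite f2N ?andbF.
- move=> [x|w] [y|w'] //.
  + by rewrite -val_eqE [val _]f1l [X in _ != X]f1l /HV dvdn_ZpB.
  + by rewrite -val_eqE [val _]f1l [X in _ != X]f1r /HW dvdn_ZpB // val_pi modn_dvdm.
  + by rewrite -val_eqE [val _]f1r [X in _ != X]f1l /HW dvdn_ZpB // val_pi modn_dvdm // eq_sym.
move=> u v _; case: and3P => // -[_ u6 v6] _.
have pre (z : 'I_t * 'I_9) : z.2 < 6 -> exists x, z = f (inl x).
  case: z => i c /= c6; have ltn : c * t + i < n by have := ltn_ord i; rewrite /n; nia.
  exists ((c * t + i)%:R)%R; apply/eqP; rewrite -pair_eqE; apply/andP; split; apply/eqP/ord_inj.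
    by rewrite f1l valK // modnMDl modn_small.
  by rewrite f2l valK // divnMDl // divn_small // addn0.
have [x ->] := pre u u6; have [y ->] := pre v v6; by exists (inl x), (inl y).
Qed.

(** * Frames from linear spaces *)

Lemma nested_frame_card (G H : finType) : #|G| = #|H| -> nested_frame G -> nested_frame H.
Proof.
move=> GH; pose h (x : G) : H := enum_val (cast_ord GH (enum_rank x)).
pose h' (y : H) : G := enum_val (cast_ord (esym GH) (enum_rank y)).
have hK : cancel h h' by move=> x; rewrite /h' /h enum_valK cast_ordK enum_rankK.
have h'K : cancel h' h by move=> x; rewrite /h' /h enum_valK cast_ordKV enum_rankK.
apply: (nested_design_inj (f := fun u => (h u.1, u.2))).
- by move=> [x i] [y j] [/(can_inj hK)-> ->].
- by move=> u v _ /=; rewrite (can_eq hK).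
- by move=> u v /=; rewrite (can_eq hK).
by move=> [x i] [y j] _ _; exists (h' x, i), (h' y, j); rewrite /= !h'K.
Qed.

(** With at most one group no pair has to be covered; this serves truncated groups of size 0 or
    1. *)
Lemma nested_frame_small t : t <= 1 -> nested_frame 'I_t.
Proof.
move=> t1; refine (nested_design_le _ _ (nested_design0 _)) => // -[i a] [j b] _ /=.
suff -> : i = j by rewrite eqxx.
by apply: ord_inj; have := ltn_ord i; have := ltn_ord j; lia.
Qed.

Section LinearSpace.
Variable G : finType.
Implicit Type l : {set G}.

Lemma nested_design_line l : nested_frame 'I_#|l| ->
  nested_design (T := (G * 'I_9)%type)
    (fun u v => [&& u.1 \in l, v.1 \in l, u.1 != v.1, u.2 < 6 & v.2 < 6] : nat)
    (fun u v => [&& u.1 \in l, v.1 \in l & u.1 != v.1] : nat).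
Proof.
apply: (nested_design_inj (f := fun u => (enum_val u.1, u.2))).
- by move=> [x i] [y j] [/enum_val_inj-> ->].
- by move=> u v _ /=; rewrite !enum_valP (inj_eq enum_val_inj).
- by move=> u v /=; rewrite !enum_valP (inj_eq enum_val_inj).
move=> [x i] [y j] _ /=; case: (boolP (x \in l)) => // xl; case: (boolP (y \in l)) => // yl _.
by exists (enum_rank_in xl x, i), (enum_rank_in xl y, j); rewrite /= !enum_rankK_in.
Qed.

(** For two distinct groups only the line through them contributes to the summed weights. Infinite
    points may be shared by the lines, as every spoke joins two distinct groups of one line. *)
Lemma nested_frame_lines (L : seq {set G}) :
    (forall x y, x != y -> count (fun l => (x \in l) && (y \in l)) L = 1) ->
    {in L, forall l : {set G}, nested_frame 'I_#|l|} ->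
  nested_frame G.
Proof.
move=> L1 Lframe.
refine (nested_design_le _ _ (nested_design_sum
  (fun l lL => nested_design_line (Lframe l lL)))) => [u v _|u v].
  have [uv|uv] := eqVneq u.1 v.1; first by rewrite big1 // => l _; rewrite !andbF.
  transitivity (count (fun l => (u.1 \in l) && (v.1 \in l)) L * ((u.2 < 6) && (v.2 < 6))).
    by rewrite L1 // mul1n.
  rewrite -sum1_count big_distrl big_mkcond /=.
  by apply: eq_bigr => l _; rewrite mul1n !andbA; case: (_ && _).
have [uv|uv] := eqVneq u.1 v.1; first by rewrite big1 // => l _; rewrite !andbF.
rewrite -[X in _ <= X](L1 _ _ uv) -sum1_count [X in _ <= X]big_mkcond /=.
by apply: leq_sum => l _; rewrite andbT; case: (_ && _).
Qed.

End LinearSpace.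

(** Columns 0 to 3 are full, columns 4 and 5 are truncated to [r] and [s]. The linear space consists
    of the six columns and one line for each slope and intercept; such a line meets every full
    column once and each truncated one at most once, hence has 4 to 6 points. *)
Lemma nested_frame_transversal q r s : 4 < q -> coprime q 6 -> r <= q -> s <= q ->
    {in [:: 4; 5; 6; q; r; s], forall t, nested_frame 'I_t} ->
  nested_frame 'I_(4 * q + r + s).
Proof.
move=> q_gt4 co_q6 rq sq fr; have q_gt1 : 1 < q by lia.
pose V : finType := ('I_4 * 'Z_q + ('I_r + 'I_s))%type.
have cardZ : #|'Z_q| = q by rewrite card_ord Zp_cast.
apply: (nested_frame_card (G := V)).
  by rewrite !card_sum card_prod !card_ord Zp_cast // addnA.
pose col (p : V) : nat := match p with inl (c, _) => c | inr (inl _) => 4 | inr (inr _) => 5 end.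
pose row (p : V) : 'Z_q := match p with
  inl (_, y) => y | inr (inl i) => (i%:R)%R | inr (inr i) => (i%:R)%R end.
have col_lt p : col p < 6 by case: p => [[c y]|[i|i]] //=; apply: ltn_trans (ltn_ord c) _.
have natr_inj m (i j : 'I_m) : m <= q -> ((i%:R)%R : 'Z_q) = (j%:R)%R -> i = j.
  move=> mq /(congr1 (@nat_of_ord _)); rewrite !val_Zp_nat // !modn_small; first exact: ord_inj.
    exact: leq_trans (ltn_ord j) mq.
  exact: leq_trans (ltn_ord i) mq.
have col_row p p' : col p = col p' -> row p = row p' -> p = p'.
  case: p p' => [[c y]|[i|i]] [[c' y']|[i'|i']] //=; try by move=> E; have := ltn_ord c; rewrite E.
  - by move=> /ord_inj-> ->.
  - by move=> E; have := ltn_ord c'; rewrite -E.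
  - by move=> _ /(natr_inj _ _ _ rq)->.
  - by move=> E; have := ltn_ord c'; rewrite -E.
  - by move=> _ /(natr_inj _ _ _ sq)->.
(* Column 5 is the group of slopes. *)
pose at_col (mb : 'Z_q * 'Z_q) c := (if c == 5 then mb.1 else mb.1 * c%:R + mb.2)%R.
pose line mb : {set V} := [set p | row p == at_col mb (col p)].
pose groups := [seq [set p | col p == c] : {set V} | c <- iota 0 6].
have line_inj mb : {in line mb &, injective col}.
  by move=> p p'; rewrite !inE => /eqP rp /eqP rp' cc; apply: col_row; rewrite // rp rp' cc.
(* Up to sign the difference of two columns below 5 is 1, 2, 3 or 4, a unit because [q] is prime to
   2 and 3. *)
have unit_sub c c' : c < 5 -> c' < 5 -> c != c' -> ((c%:R - c'%:R)%R : 'Z_q) \is a GRing.unit.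
  wlog lt_c : c c' / c' < c.
    move=> IH c5 c'5 cc; have [lt_c|le_c] := ltnP c' c; first exact: IH.
    by rewrite -opprB unitrN; apply: IH; rewrite // 1?eq_sym // ltn_neqAle cc.
  move=> c5 c'5 _; rewrite -natrB ?(ltnW lt_c) // unitZpE //.
  move: co_q6; rewrite -[6]/(2 * 3) coprimeMr => /andP[q2 q3].
  have : 0 < c - c' < 5 by lia.
  case: (c - c') => [|[|[|[|[|]]]]] // _; rewrite ?coprimen1 //.
  by rewrite -[4]/(2 * 2) coprimeMr q2.
(* A point in column 5 fixes the slope outright; otherwise the slope is the row difference divided
   by the column difference. The intercept follows from a point outside column 5. *)
have one_line p p' : col p != col p' ->
    exists mb0, forall mb, (p \in line mb) && (p' \in line mb) = (mb == mb0).
  have [c5 cc|c5] := eqVneq (col p) 5.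
    have c'5 : (col p' == 5) = false by rewrite -c5 eq_sym; apply: negbTE.
    exists (row p, row p' - row p * (col p')%:R)%R => -[m b].
    rewrite !inE /at_col c5 eqxx c'5 /= -pair_eqE /= eq_sym.
    by case: eqP => //= ->; rewrite addrC -subr_eq eq_sym.
  have [c'5 cc|c'5 cc] := eqVneq (col p') 5.
    exists (row p', row p - row p' * (col p)%:R)%R => -[m b].
    rewrite !inE /at_col c'5 eqxx (negbTE c5) /= -pair_eqE /= andbC eq_sym.
    by case: eqP => //= ->; rewrite addrC -subr_eq eq_sym.
  have lt5 p1 : col p1 != 5 -> col p1 < 5 by have := col_lt p1; lia.
  have U := unit_sub _ _ (lt5 _ c5) (lt5 _ c'5) cc.
  pose m0 := ((row p - row p') / ((col p)%:R - (col p')%:R))%R.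
  exists (m0, row p - m0 * (col p)%:R)%R => -[m b].
  rewrite !inE /at_col (negbTE c5) (negbTE c'5) /= -pair_eqE /=.
  apply/andP/andP => [[/eqP rp /eqP rp']|[/eqP-> /eqP->]].
    have -> : m0 = m.
      by apply: (mulIr U); rewrite divrK // rp rp' opprD addrACA subrr addr0 mulrBr.
    by rewrite rp addrC addKr.
  split; first by rewrite addrC subrK.
  by rewrite addrCA -opprB -mulrBr divrK // subKr.
apply: (nested_frame_lines (L := groups ++ [seq line mb | mb <- enum {: 'Z_q * 'Z_q}])).
  move=> p p' pp'; rewrite count_cat /groups !count_map.
  (* Points of one column share that column and no line; points of distinct columns share one line
     and no column. *)
  have [cc|cc] := eqVneq (col p) (col p').
    rewrite [X in _ + X](eq_count (a2 := pred0)) => [|mb]; last first.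
      by apply/negbTE/negP => /= /andP[pl p'l]; case/eqP: pp'; apply: (line_inj mb p p' pl p'l cc).
    rewrite count_pred0 addn0 (eq_count (a2 := pred1 (col p))) => [|c]; last first.
      by rewrite /= !inE -cc andbb eq_sym.
    by rewrite count_uniq_mem ?iota_uniq // mem_iota /= col_lt.
  rewrite (eq_count (a2 := pred0)) => [|c]; last first.
    by apply/negbTE/negP; rewrite /= !inE => /andP[/eqP pc /eqP p'c]; case/eqP: cc; rewrite pc.
  have [mb0 mb0P] := one_line _ _ cc.
  rewrite count_pred0 add0n (eq_count (a2 := pred1 mb0)) => [|mb]; last by rewrite /= mb0P.
  by rewrite -enumT count_uniq_mem ?enum_uniq // mem_enum.
move=> l; rewrite mem_cat => /orP[/mapP[c]|/mapP[mb _ ->]].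
  rewrite mem_iota /= => c6 ->.
  have [c4|c4] := ltnP c 4.
    have -> : [set p | col p == c] = [set (inl (Ordinal c4, y) : V) | y : 'Z_q].
      apply/setP => p; rewrite inE; apply/eqP/imsetP => [|[y _ ->]] //.
      case: p => [[c' y]|[i|i]] /= cE; try (exfalso; lia).
      by exists y => //; congr (inl (_, _)); apply: ord_inj.
    by rewrite card_imset => [|y y' []//]; rewrite cardZ; apply: fr; rewrite !inE eqxx !orbT.
  have : (c == 4) || (c == 5) by lia.
  case/orP => /eqP->.
    have -> : [set p | col p == 4] = [set (inr (inl i) : V) | i : 'I_r].
      apply/setP => p; rewrite inE; apply/eqP/imsetP => [|[y _ ->]] //.
      case: p => [[c' y]|[i|i]] //= cE; last by exists i.
      by have := ltn_ord c'; rewrite cE.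
    by rewrite card_imset => [|y y' []//]; rewrite card_ord; apply: fr; rewrite !inE eqxx !orbT.
  have -> : [set p | col p == 5] = [set (inr (inr i) : V) | i : 'I_s].
    apply/setP => p; rewrite inE; apply/eqP/imsetP => [|[y _ ->]] //.
    case: p => [[c' y]|[i|i]] //= cE; last by exists i.
    by have := ltn_ord c'; rewrite cE.
  by rewrite card_imset => [|y y' []//]; rewrite card_ord; apply: fr; rewrite !inE eqxx !orbT.
have ge4 : 4 <= #|line mb|.
  have inj : injective (fun c : 'I_4 => inl (c, at_col mb c) : V) by move=> c c' [].
  rewrite -[4]card_ord -(card_imset _ inj); apply/subset_leq_card/subsetP => _ /imsetP[c _ ->].
  by rewrite inE.
have le6 : #|line mb| <= 6.
  rewrite cardE -(size_map col) -(size_iota 0 6); apply: uniq_leq_size.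
    rewrite map_inj_in_uniq ?enum_uniq // => p p'; rewrite !mem_enum; exact: line_inj.
  by move=> c /mapP[p _ ->]; rewrite mem_iota col_lt.
by apply: fr; rewrite !inE; lia.
Qed.

(** * Filling the groups and passing to BIBDs *)

(** The triples are [{5, i, i+1}] nested at [i+2] and [{i, i+1, i+3}] nested at [6+i], for [i] over
    Z_5 with 5 fixed. Points 9 and 10 are to be shared by all groups, so the bound leaves out the
    pair they form. *)
Lemma nested_design_hole : nested_design (T := 'I_(9 + 2))
  (fun x y => (x < 6) && (y < 6) : nat)
  (fun x y => (x != y) && ((x < 9) || (y < 9)) : nat).
Proof.
(* Points 0-5, infinite points 6-8 of the group, and the two extra points 9 and 10. *)
pose s : seq (seq nat * nat) :=
  [:: ([:: 5; 0; 1], 2); ([:: 5; 1; 2], 3); ([:: 5; 2; 3], 4); ([:: 5; 3; 4], 0);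
      ([:: 5; 4; 0], 1); ([:: 0; 1; 3], 6); ([:: 1; 2; 4], 7); ([:: 2; 3; 0], 8);
      ([:: 3; 4; 1], 9); ([:: 4; 0; 2], 10)].
pose s' : seq (seq 'I_(9 + 2) * 'I_(9 + 2)) := [seq (map inord p.1, inord p.2) | p <- s].
have s'E : [seq (map val p.1, val p.2) | p <- s'] = s by rewrite /= !inordK.
have memE (x : 'I_(9 + 2)) p : (x \in p) = (val x \in map val p).
  by rewrite (mem_map val_inj).
have covE x y : covers s' x y = covers s (val x) (val y).
  by rewrite -s'E /covers [RHS]count_map; apply: eq_count => p /=; rewrite !memE.
have spkE x y : spokes s' x y = spokes s (val x) (val y).
  by rewrite -s'E /spokes [RHS]count_map; apply: eq_count => p /=; rewrite memE.
have check : all (fun x => all (fun y =>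
    [&& (x != y) ==> (covers s x y == 2 * ((x < 6) && (y < 6)))
      & spokes s x y + spokes s y x <= (x != y) && ((x < 9) || (y < 9))]) (iota 0 11)) (iota 0 11).
  by vm_compute.
have checkP (x y : 'I_(9 + 2)) := allP (allP check x ltac:(by rewrite mem_iota ltn_ord)) y
  ltac:(by rewrite mem_iota ltn_ord).
exists s'; split.
- have : triples_in s by [].
  rewrite -s'E /triples_in all_map; apply: sub_all => p /=.
  by rewrite (map_inj_uniq val_inj) size_map.
- by move=> x y xy; rewrite covE; have /andP[/implyP/(_ xy)/eqP] := checkP x y.
by move=> x y; rewrite !spkE; have /andP[] := checkP x y.
Qed.

Section FillHoles.
Variables (G : finType) (g : G).
Let T : finType := (G * 'I_9 + 'I_2)%type.

Definition in_hole (u : T) := if u is inl x then x.1 == g else false.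
Definition in_hull (u : T) := if u is inl x then x.1 == g else true.
Definition is_point (u : T) := if u is inl x then x.2 < 6 else false.

(** The nested (6,3,2)-BIBD is placed on one group and the two extra points. Requiring an end of
    each spoke in the group itself keeps the bounds for different groups from overlapping. *)
Lemma nested_design_in_hole : nested_design (T := T)
  (fun u v => [&& in_hole u, in_hole v, is_point u & is_point v] : nat)
  (fun u v => [&& u != v, in_hull u, in_hull v & in_hole u || in_hole v] : nat).
Proof.
pose f (x : 'I_(9 + 2)) : T := match split x with inl i => inl (g, i) | inr j => inr j end.
pose f' (u : T) : 'I_(9 + 2) := match u with inl x => lshift 2 x.2 | inr j => rshift 9 j end.
have fK : cancel f f' by move=> x; rewrite /f /f' -[RHS]splitK; case: split.
have f'K u : in_hull u -> f (f' u) = u.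
  case: u => [[h i]|j] /=.
    by move=> /eqP->; rewrite /f -[lshift _ _]/(unsplit (inl i)) unsplitK.
  by move=> _; rewrite /f -[rshift _ _]/(unsplit (inr j)) unsplitK.
have hullf x : in_hull (f x) by rewrite /f; case: split => //= i.
have holef x : in_hole (f x) = (x < 9).
  by rewrite /f; case: (split_ordP x) => j _ /=; rewrite ?eqxx.
have pointf x : is_point (f x) = (x < 6).
  by rewrite /f; case: (split_ordP x) => j ->.
apply: (nested_design_inj (f := f)) nested_design_hole.
- exact: can_inj fK.
- move=> x y _; rewrite !holef !pointf; congr nat_of_bool.
  by apply/and4P/andP => [[]//|[x6 y6]]; split=> //; apply: ltn_trans (_ : 6 < 9).
- by move=> x y; rewrite (can_eq fK) !hullf !holef.
have hole_hull u : in_hole u -> in_hull u by case: u.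
move=> u v _; rewrite lt0b => /and4P[uh vh _ _]; exists (f' u), (f' v).
by rewrite !f'K ?hole_hull.
Qed.

End FillHoles.

(** The frame serves pairs from distinct groups; a pair inside a group, or joining it to an extra
    point, is served only by the filling of that group, and the two extra points are never joined.
    Hence the summed weights are at most 1. *)
Lemma nested_frame_fill t : nested_frame 'I_t ->
  nested_design (T := ('I_t * 'I_9 + 'I_2)%type)
    (fun u v => is_point u && is_point v : nat) (fun u v => u != v : nat).
Proof.
move=> fr.
have base : nested_design (T := ('I_t * 'I_9 + 'I_2)%type)
  (fun u v => if (u, v) is (inl x, inl y) then [&& x.1 != y.1, x.2 < 6 & y.2 < 6] : nat else 0)
  (fun u v => if (u, v) is (inl x, inl y) then x.1 != y.1 : nat else 0).
  apply: (nested_design_inj (f := inl)) fr => //; first by move=> x y [].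
  by move=> [x|i] [y|j] // _ _; exists x, y.
refine (nested_design_le _ _ (nested_designD base (nested_design_sum (ks := enum 'I_t)
  (fun g _ => nested_design_in_hole g)))).
- move=> [x|i] [y|j] /= xy; rewrite ?andbF ?add0n; try by rewrite big1 // => g _; rewrite ?andbF.
  have [xy1|xy1] := eqVneq x.1 y.1; last first.
    rewrite /= big1 ?addn0 // => g _.
    by have [<-|] := eqVneq x.1 g; rewrite //= [y.1 == _]eq_sym (negbTE xy1).
  rewrite add0n big_enum (bigD1 x.1) //= -xy1 eqxx big1 ?addn0 //= => g.
  by rewrite eq_sym => /negbTE->.
move=> [x|i] [y|j] /=.
- have [xy1|xy1] := eqVneq x.1 y.1.
    rewrite add0n big_enum (bigD1 x.1) //= -xy1 eqxx big1 ?addn0 /= => [|g].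
      by rewrite andbT.
    by rewrite eq_sym => /negbTE->; rewrite andbF.
  rewrite /= big1 ?addn0 => [|g _].
    by rewrite lt0b; apply: contraNneq xy1 => -[->].
  have [<-|] := eqVneq x.1 g; rewrite //= ?andbF // [y.1 == _]eq_sym (negbTE xy1) ?andbF //.
- rewrite add0n big_enum (bigD1 x.1) //= eqxx big1 ?addn0 //= => g.
  by rewrite eq_sym => /negbTE->.
- rewrite add0n big_enum (bigD1 y.1) //= eqxx big1 ?addn0 //= => g.
  by rewrite eq_sym => /negbTE->; rewrite ?andbF.
by rewrite big1 // => g _; rewrite andbF.
Qed.

Lemma nested_frame_BIBD t : nested_frame 'I_t ->
  exists (X : {set 'I_(9 * t + 2)}) (b : nat)
         (B : 'I_b -> {set 'I_(9 * t + 2)}) (phi : 'I_b -> 'I_(9 * t + 2)),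
    is_BIBD X (6 * t) 3 2 B /\ strong_nesting B phi.
Proof.
move=> /nested_frame_fill D; set T : finType := ('I_t * 'I_9 + 'I_2)%type in D.
have cardT : #|T| = 9 * t + 2 by rewrite card_sum card_prod !card_ord mulnC.
pose h (u : T) := cast_ord cardT (enum_rank u).
pose h' i : T := enum_val (cast_ord (esym cardT) i).
have hK : cancel h h' by move=> u; rewrite /h /h' cast_ordK enum_rankK.
have h'K : cancel h' h by move=> i; rewrite /h /h' enum_valK cast_ordKV.
pose X : {set 'I_(9 * t + 2)} := [set i | is_point (h' i)].
have cardX : #|X| = 6 * t.
  have -> : X = [set h (inl (ic.1, widen_ord (isT : 6 <= 9) ic.2)) | ic : 'I_t * 'I_6].
    apply/setP => i; rewrite inE; apply/idP/imsetP => [|[ic _ ->]]; last by rewrite hK /= ltn_ord.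
    rewrite -{2}(h'K i); case: (h' i) => [[g c] /= c6|//].
    by exists (g, Ordinal c6) => //; congr (h (inl (_, _))); apply: ord_inj.
  rewrite card_imset ?card_prod ?card_ord 1?mulnC // => -[g c] [g' c'] /(can_inj hK)[-> cc].
  by congr (_, _); apply: ord_inj.
exists X; rewrite -cardX.
apply: (nested_design_BIBD (E := fun i j => (i \in X) && (j \in X)) (N := fun i j => i != j)) => //.
apply: (nested_design_inj (f := h)) D.
- exact: can_inj hK.
- by move=> u v _; rewrite !inE !hK.
- by move=> u v; rewrite (can_eq hK).
by move=> i j _ _; exists (h' i), (h' j); rewrite !h'K.
Qed.

(* The entry [(t, a, b)] lists the base blocks [As] and [Bs] of a [frame_starter t], three
   consecutive numbers forming a block. *)
Definition starters : seq (nat * seq nat * seq nat) :=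
  [::
    (4, [:: 5; 18; 7; 11; 10; 13; 21; 3; 2],
     [:: 2; 5; 11; 17; 10; 3; 23; 18; 9]);
    (5, [:: 7; 19; 18; 23; 27; 21; 26; 17; 29; 9; 16; 13],
     [:: 6; 22; 23; 13; 29; 21; 27; 16; 18; 28; 11; 4]);
    (6, [:: 17; 32; 13; 25; 21; 34; 29; 27; 22; 15; 1; 2; 5; 10; 26],
     [:: 20; 28; 11; 22; 32; 29; 27; 1; 2; 13; 10; 21; 19; 5; 3]);
    (7, [:: 12; 24; 15; 8; 10; 16; 18; 1; 20; 25; 30; 5; 32; 6; 19; 38; 34; 2],
     [:: 11; 20; 38; 36; 12; 9; 16; 32; 27; 29; 37; 41; 17; 39; 40; 34; 24; 23]);
    (8, [:: 45; 14; 11; 41; 26; 30; 23; 10; 28; 43; 5; 31; 36; 22; 1; 44; 33; 37; 27; 39; 18],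
     [:: 20; 45; 38; 43; 17; 15; 25; 26; 27; 9; 14; 42; 47; 18; 37; 2; 44; 41; 36; 19; 13]);
    (9, [:: 26; 13; 15; 51; 30; 43; 19; 25; 21; 11; 8; 1; 50; 7; 31; 33; 2; 12; 44; 10; 5; 41;
    47; 22],
     [:: 30; 4; 42; 53; 25; 11; 38; 46; 21; 39; 44; 40; 5; 2; 22; 31; 47; 17; 26; 48; 41; 51;
    19; 20]);
    (10, [:: 58; 35; 59; 19; 42; 16; 38; 27; 45; 56; 44; 13; 52; 18; 21; 2; 4; 37; 33; 24; 25;
    31; 47; 36; 11; 9; 53],
     [:: 14; 18; 26; 58; 7; 52; 12; 55; 33; 24; 3; 39; 31; 38; 25; 4; 23; 9; 17; 45; 49; 13; 32;
    59; 16; 41; 54]);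
    (11, [:: 26; 42; 3; 28; 65; 62; 31; 37; 52; 41; 16; 56; 60; 48; 39; 25; 5; 51; 14; 10; 7; 1;
    50; 57; 63; 35; 53; 13; 21; 45],
     [:: 2; 43; 7; 36; 17; 5; 37; 13; 60; 9; 4; 10; 32; 63; 46; 18; 45; 47; 51; 38; 52; 31; 1;
    39; 50; 54; 41; 26; 24; 8]);
    (12, [:: 15; 69; 22; 34; 43; 41; 29; 3; 6; 17; 20; 67; 13; 47; 21; 28; 23; 45; 66; 37; 38;
    46; 25; 27; 55; 16; 32; 50; 40; 44; 71; 54; 26],
     [:: 11; 68; 6; 54; 43; 14; 40; 59; 55; 5; 26; 63; 70; 37; 28; 15; 50; 56; 47; 27; 7; 39; 1;
    31; 38; 52; 51; 62; 8; 49; 19; 30; 3]);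
    (13, [:: 44; 43; 61; 19; 55; 20; 51; 28; 9; 63; 6; 53; 35; 30; 1; 73; 11; 64; 3; 27; 23; 31;
    76; 54; 18; 32; 77; 21; 33; 68; 75; 7; 47; 49; 41; 17],
     [:: 28; 22; 30; 33; 58; 36; 57; 43; 77; 68; 73; 11; 14; 29; 2; 23; 25; 19; 47; 38; 75; 74;
    37; 44; 71; 54; 8; 18; 66; 15; 72; 61; 32; 9; 16; 27]);
    (14, [:: 16; 49; 9; 71; 68; 67; 44; 43; 64; 45; 79; 40; 36; 21; 10; 65; 69; 59; 38; 11; 20;
    24; 47; 57; 46; 34; 72; 13; 60; 75; 83; 61; 31; 48; 35; 32; 39; 50; 12],
     [:: 49; 47; 40; 10; 57; 63; 64; 76; 59; 53; 22; 82; 83; 58; 75; 29; 5; 54; 39; 3; 23; 18;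
    52; 73; 69; 67; 24; 50; 7; 68; 13; 43; 78; 4; 12; 48; 33; 65; 46]);
    (15, [:: 35; 40; 13; 7; 31; 27; 38; 61; 18; 59; 21; 77; 50; 17; 11; 23; 64; 51; 2; 87; 78;
    57; 29; 20; 39; 10; 4; 79; 48; 69; 37; 73; 8; 9; 43; 26; 89; 70; 1; 86; 36; 22],
     [:: 20; 39; 31; 4; 61; 62; 87; 37; 1; 69; 26; 18; 13; 38; 50; 68; 27; 24; 23; 11; 55; 25;
    47; 48; 58; 74; 76; 85; 8; 88; 46; 84; 73; 56; 80; 49; 83; 9; 57; 19; 54; 12]);
    (16, [:: 91; 61; 56; 53; 47; 24; 86; 23; 10; 7; 89; 17; 36; 49; 92; 33; 28; 57; 3; 78; 77;
    75; 94; 87; 73; 18; 19; 59; 63; 14; 70; 82; 85; 31; 6; 93; 88; 90; 69; 2; 4; 83; 20; 12;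
    26],
     [:: 24; 94; 76; 74; 46; 15; 93; 67; 28; 88; 31; 85; 95; 86; 58; 66; 26; 36; 77; 17; 42; 92;
    45; 41; 33; 6; 56; 39; 12; 5; 75; 83; 37; 14; 47; 25; 89; 34; 78; 23; 43; 61; 69; 9; 52]);
    (17, [:: 14; 44; 40; 21; 61; 46; 90; 11; 20; 77; 70; 7; 53; 80; 88; 43; 23; 69; 13; 42; 78;
    4; 31; 47; 38; 66; 56; 32; 60; 84; 45; 86; 63; 81; 59; 50; 92; 54; 48; 73; 1; 57; 28; 67;
    25; 36; 49; 24],
     [:: 91; 4; 42; 49; 37; 35; 23; 58; 1; 7; 14; 80; 50; 19; 97; 81; 78; 38; 40; 27; 48; 69;
    70; 71; 73; 26; 84; 28; 89; 47; 77; 66; 56; 45; 93; 39; 30; 82; 87; 100; 3; 86; 6; 10; 43;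
    94; 61; 12]);
    (18, [:: 43; 95; 75; 92; 59; 44; 48; 93; 28; 46; 85; 73; 2; 87; 65; 6; 57; 4; 62; 53; 25;
    67; 24; 104; 12; 89; 7; 99; 86; 91; 88; 29; 26; 106; 96; 81; 76; 84; 101; 10; 49; 40; 55;
    51; 17; 68; 16; 74; 63; 23; 69],
     [:: 87; 101; 46; 14; 27; 61; 60; 44; 91; 88; 24; 102; 98; 25; 9; 82; 86; 65; 75; 34; 63;
    96; 85; 15; 5; 106; 71; 30; 89; 41; 50; 107; 28; 3; 4; 79; 55; 13; 11; 32; 100; 42; 69; 92;
    68; 38; 31; 57; 52; 73; 49]);
    (19, [:: 52; 69; 106; 22; 27; 58; 40; 75; 64; 70; 93; 6; 34; 81; 42; 10; 111; 66; 62; 59;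
    53; 92; 71; 29; 74; 41; 89; 77; 88; 25; 83; 46; 61; 11; 94; 85; 113; 43; 39; 107; 73; 45;
    65; 55; 87; 44; 3; 48; 80; 21; 108; 104; 33; 72],
     [:: 33; 31; 80; 3; 103; 104; 21; 37; 44; 78; 58; 5; 90; 64; 35; 60; 106; 17; 92; 14; 12;
    74; 98; 84; 62; 2; 18; 49; 61; 67; 1; 85; 13; 7; 25; 91; 51; 71; 72; 15; 41; 48; 105; 59;
    108; 69; 86; 94; 27; 32; 88; 75; 110; 46]);
    (23, [:: 6; 84; 97; 78; 126; 19; 48; 120; 109; 72; 42; 37; 108; 132; 67; 24; 60; 43; 36; 90;
    7; 54; 66; 91; 12; 30; 79; 18; 114; 61; 96; 102; 103; 8; 134; 118; 104; 86; 16; 110; 14; 70;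
    50; 44; 82; 98; 20; 100; 32; 122; 58; 2; 68; 64; 26; 56; 4; 62; 38; 52; 116; 80; 124; 128;
    74; 94],
     [:: 111; 14; 125; 63; 44; 107; 129; 20; 11; 21; 122; 5; 135; 68; 65; 99; 56; 17; 45; 38;
    83; 33; 80; 113; 15; 74; 89; 57; 134; 53; 51; 86; 137; 71; 54; 104; 95; 12; 110; 131; 18;
    50; 47; 96; 98; 59; 6; 32; 77; 78; 2; 35; 48; 26; 41; 72; 62; 119; 108; 116; 29; 24; 128;
    101; 36; 8]);
    (27, [:: 70; 22; 138; 127; 94; 106; 130; 146; 15; 18; 73; 115; 51; 107; 5; 109; 104; 60;
    137; 39; 10; 19; 69; 126; 118; 29; 35; 158; 64; 87; 7; 159; 129; 105; 43; 61; 134; 147; 140;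
    17; 144; 14; 113; 111; 139; 149; 4; 80; 143; 11; 12; 40; 52; 155; 9; 16; 20; 128; 36; 148;
    38; 75; 89; 31; 72; 76; 102; 50; 125; 114; 136; 71; 84; 1; 79; 122; 42; 2],
     [:: 60; 123; 131; 110; 100; 76; 115; 94; 160; 122; 58; 49; 118; 16; 90; 13; 150; 51; 48;
    141; 105; 14; 73; 140; 107; 121; 25; 17; 126; 75; 19; 35; 96; 24; 43; 23; 83; 74; 159; 106;
    11; 103; 132; 8; 98; 97; 112; 130; 117; 134; 95; 136; 80; 78; 85; 147; 33; 4; 92; 53; 120;
    133; 157; 63; 124; 34; 155; 71; 18; 69; 37; 156; 153; 161; 10; 46; 20; 61]);
    (31, [:: 23; 125; 130; 185; 35; 148; 89; 47; 34; 77; 95; 136; 29; 101; 172; 51; 21; 11; 111;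
    177; 137; 165; 57; 83; 9; 135; 53; 129; 75; 119; 184; 138; 63; 178; 180; 159; 154; 162; 171;
    58; 90; 33; 46; 174; 39; 147; 110; 12; 123; 68; 48; 27; 86; 6; 15; 158; 24; 153; 74; 96;
    103; 164; 131; 133; 98; 59; 67; 20; 143; 175; 80; 107; 49; 134; 149; 52; 28; 64; 22; 112;
    70; 88; 76; 94; 166; 118; 4; 106; 100; 16],
     [:: 100; 96; 130; 28; 12; 148; 112; 48; 34; 76; 6; 136; 118; 24; 172; 183; 70; 137; 81; 94;
    83; 45; 4; 53; 87; 16; 119; 69; 64; 11; 114; 17; 164; 84; 161; 98; 150; 179; 20; 42; 65; 80;
    168; 167; 134; 58; 35; 157; 46; 47; 163; 184; 95; 1; 178; 101; 97; 154; 125; 109; 41; 153;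
    142; 71; 147; 10; 5; 123; 40; 113; 27; 160; 173; 15; 82; 78; 143; 9; 126; 107; 129; 132;
    149; 51; 156; 131; 111; 66; 59; 165]);
    (43, [:: 169; 135; 71; 139; 195; 179; 67; 81; 77; 49; 117; 245; 109; 255; 29; 253; 225; 233;
    31; 153; 155; 235; 228; 4; 91; 186; 130; 55; 240; 226; 175; 60; 250; 205; 144; 256; 19; 36;
    64; 37; 138; 16; 208; 70; 149; 52; 82; 5; 142; 214; 227; 100; 118; 89; 154; 94; 119; 232;
    88; 191; 58; 22; 209; 164; 90; 123; 170; 216; 63; 236; 54; 177; 188; 78; 141; 176; 84; 3;
    44; 150; 33; 140; 102; 105; 163; 201; 39; 73; 147; 171; 115; 69; 75; 61; 243; 51; 241; 93;
    45; 157; 249; 237; 7; 159; 27; 152; 257; 143; 38; 161; 197; 74; 137; 17; 212; 131; 101; 182;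
    65; 251; 110; 113; 95; 92; 125; 185],
     [:: 31; 147; 244; 169; 69; 190; 139; 243; 112; 67; 93; 28; 49; 249; 136; 109; 159; 34; 253;
    201; 202; 145; 157; 92; 133; 7; 152; 1; 163; 38; 97; 73; 74; 121; 115; 212; 127; 61; 182;
    193; 241; 110; 19; 36; 41; 37; 138; 107; 235; 228; 59; 91; 186; 47; 55; 240; 173; 175; 60;
    11; 205; 144; 35; 90; 229; 160; 216; 25; 40; 54; 103; 10; 78; 187; 196; 84; 79; 178; 150;
    181; 238; 102; 13; 124; 82; 132; 4; 214; 162; 130; 118; 234; 226; 94; 252; 250; 88; 192;
    256; 22; 48; 64; 70; 12; 16; 3; 26; 207; 33; 200; 213; 105; 50; 21; 123; 206; 231; 63; 116;
    219; 177; 158; 87; 141; 104; 183]);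
    (47, [:: 144; 156; 230; 162; 246; 200; 6; 30; 272; 42; 210; 212; 12; 60; 74; 84; 138; 236;
    24; 120; 242; 168; 276; 2; 48; 240; 14; 54; 270; 98; 96; 198; 122; 108; 258; 8; 192; 114;
    56; 216; 234; 110; 102; 228; 206; 150; 186; 32; 204; 174; 224; 18; 90; 158; 126; 66; 260;
    36; 180; 128; 252; 132; 50; 72; 78; 68; 222; 264; 194; 104; 91; 271; 164; 73; 205; 20; 229;
    25; 140; 193; 175; 134; 223; 97; 92; 151; 115; 80; 211; 241; 278; 67; 277; 254; 187; 247;
    86; 181; 37; 38; 139; 259; 266; 127; 121; 170; 43; 1; 62; 19; 7; 152; 133; 49; 218; 85; 61;
    116; 31; 145; 248; 217; 169; 44; 109; 55; 26; 199; 103; 182; 265; 157; 146; 163; 253; 176;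
    13; 79],
     [:: 93; 240; 88; 87; 270; 52; 45; 198; 82; 33; 258; 10; 231; 114; 70; 207; 234; 208; 39;
    228; 46; 273; 186; 40; 219; 174; 280; 123; 90; 268; 15; 66; 184; 105; 180; 160; 171; 132;
    274; 69; 78; 226; 201; 264; 172; 279; 156; 76; 261; 246; 250; 135; 30; 58; 99; 210; 124;
    129; 60; 22; 57; 138; 154; 117; 120; 232; 255; 276; 214; 266; 67; 11; 170; 187; 77; 62; 181;
    257; 152; 139; 107; 218; 127; 185; 116; 43; 167; 248; 19; 41; 44; 133; 5; 26; 85; 35; 182;
    31; 245; 146; 217; 23; 176; 109; 161; 104; 199; 281; 164; 265; 275; 20; 163; 233; 140; 13;
    221; 134; 91; 137; 92; 73; 113; 80; 229; 227; 278; 193; 179; 254; 223; 125; 86; 151; 29; 38;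
    211; 203])].

(** * Verification of the starters, and reduction of every [t >= 4] to them *)

Definition chunks3 (s : seq nat) := reshape (nseq (size s %/ 3) 3) s.

Lemma startersP : all (fun e => frame_starter e.1.1 (chunks3 e.1.2) (chunks3 e.2)) starters.
Proof. by vm_compute. Qed.

Lemma nested_frame_starters t : t \in map (fun e => e.1.1) starters -> nested_frame 'I_t.
Proof. by move=> /mapP[e /(allP startersP)/starter_frame fr ->]. Qed.

(** The sizes 2 and 3 are barred for the truncated groups: sizes 0 and 1 carry a trivial frame, and
    sizes from 4 on come by induction. *)
Definition truncation t q r s :=
  [&& 4 < q, coprime q 6, r <= q, s <= q, (r <= 1) || (3 < r), (s <= 1) || (3 < s)
    & t == 4 * q + r + s].

(** It is enough to find [q] prime to 6 with [4q + 4 <= t <= 6q]: then [t - 4q] splits into two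
    parts at most [q], neither of them 2 or 3. *)
Lemma ex_truncation t : 47 < t -> exists q r s, truncation t q r s.
Proof.
move=> t48; suff [q [q7 q6 tq]] : exists q, [/\ 7 <= q, (q %% 6 == 1) || (q %% 6 == 5)
    & 4 * q + 4 <= t <= 6 * q].
  have co_q6 : coprime q 6 by rewrite -coprime_modl; case/orP: q6 => /eqP->.
  have [u_le|u_gt] := leqP t (5 * q).
    by exists q, (t - 4 * q), 0; rewrite /truncation co_q6; lia.
  (* The choice [r = q] leaves [s = t - 5q]; when that is 2 or 3, four units move from [r] to
     [s]. *)
  have [u2|u2] := boolP ((t == 5 * q + 2) || (t == 5 * q + 3)).
    by exists q, (q - 4), (t - 5 * q + 4); rewrite /truncation co_q6; lia.
  by exists q, q, (t - 5 * q); rewrite /truncation co_q6; lia.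
(* Here [i >= 2], as [t >= 48]. Then [q = 6i - 1] serves [24i <= t <= 36i - 6], and [q = 6i + 1],
   with range from [24i + 8] to [36i + 6], serves the rest. *)
have [i [j [tE j24]]] : exists i j, t = 24 * i + j /\ j < 24.
  by exists (t %/ 24), (t %% 24); lia.
have [j_le|j_gt] := leqP j (12 * i - 6); first by exists (6 * i - 1); split; lia.
by exists (6 * i + 1); split; lia.
Qed.

Lemma starter_or_truncation t : 3 < t ->
  t \in map (fun e => e.1.1) starters \/ exists q r s, truncation t q r s.
Proof.
move=> t4; have [/ex_truncation|t47] := ltnP 47 t; first by right.
(* For [4 <= t <= 47] outside the table, [q] among 5, 7, 11 with [r] and [s] at most 7 suffices. *)
have : all (fun t => (t \in map (fun e => e.1.1) starters) ||
    has (fun q => has (fun r => has (truncation t q r) (iota 0 8)) (iota 0 8)) [:: 5; 7; 11])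
    (iota 4 44).
  by vm_compute.
move=> /allP/(_ t); rewrite mem_iota => /(_ ltac:(lia))/orP[|/hasP[q _ /hasP[r _ /hasP[s _ H]]]].
  by left.
by right; exists q, r, s.
Qed.

(** Strong induction: in a truncation [t >= 4q >= 20], so each of the sizes 4, 5, 6, [q], [r], [s]
    is below [t], and those below 4 are 0 or 1. *)
Lemma nested_frame_ge4 t : 3 < t -> nested_frame 'I_t.
Proof.
elim/ltn_ind: t => t IH /starter_or_truncation[/nested_frame_starters//|[q [r [s]]]].
move=> /and5P[q5 q6 rq sq /and3P[r_ok s_ok /eqP tE]]; rewrite tE.
apply: nested_frame_transversal => // k kin.
have [|k4] := ltnP 3 k; last first.
  apply: nested_frame_small; move: kin; rewrite !inE; lia.
by apply: IH; move: kin; rewrite !inE; lia.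
Qed.

(* Y is modelled as the finite type 'I_w with w = 9t+2; X is a subset of Y. *)
Theorem theorem4p6 (t : nat) (ht : 4 <= t) (ht6 : t != 6) :
  exists (X : {set 'I_(9 * t + 2)}) (b : nat)
         (B : 'I_b -> {set 'I_(9 * t + 2)}) (phi : 'I_b -> 'I_(9 * t + 2)),
    is_BIBD X (6 * t) 3 2 B /\ strong_nesting B phi.
Proof. exact: nested_frame_BIBD (nested_frame_ge4 ht). Qed.
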